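(* Let $w$ be a permutation that avoids the pattern $1423$ (i.e. $p_{1423}(w)=0$). Then $c_w(\beta)\in\mathbb{Z}_{\ge 0}[\beta]$. Equivalently, $\Upsilon_w(\beta)=\sum_{v} c_v(\beta)\,p_v(w)$ with all $c_v(\beta)$ appearing (namely those $v$ with $p_v(w)>0$) having nonnegative integer coefficients.
   Context: $S_n$ is the set of permutations of $\{1,\dots,n\}$ in one-line notation $w=w(1)\cdots w(n)$; $S_0=\{\emptyset\}$. For $w\in S_n$, the $\beta$-Grothendieck polynomial $\mathfrak{G}^{(\beta)}_w(x)\in\mathbb{Z}[\beta][x_1,\dots,x_n]$ is defined by $\mathfrak{G}^{(\beta)}_{w_0}=x_1^{n-1}x_2^{n-2}\cdots x_{n-1}$ for $w_0=n\cdots21$, and $\mathfrak{G}^{(\beta)}_w=\pi_i\,\mathfrak{G}^{(\beta)}_{ws_i}$ whenever $w(i)<w(i+1)$, where $ws_i$ swaps the entries in positions $i,i+1$, $\pi_i(f)=\partial_i\big((1+\beta x_{i+1})f\big)$ and $\partial_i f=(f-s_if)/(x_i-x_{i+1})$ with $s_i$ swapping $x_i,x_{i+1}$ (this is independent of choices). The principal specialization is $\Upsilon_w(\beta)=\mathfrak{G}^{(\beta)}_w(1,\dots,1)$, with $\Upsilon_\emptyset(\beta)=1$. All words have distinct positive integer entries. For words $u,v$, $u\le v$ means $u$ is a subword (subsequence) of $v$; $\emptyset\le v$ always; $|v|$ is the number of entries. $\mathrm{perm}(v)$ is the permutation with entries in the same relative order as $v$ (e.g. $\mathrm{perm}(2574)=1342$).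 For $u\in S_m$, $w\in S_n$, $p_u(w)$ is the number of subwords $v\le w$ (i.e. choices of positions) with $\mathrm{perm}(v)=u$; $p_\emptyset(w)=1$; $w$ avoids $u$ if $p_u(w)=0$. Define $c_w(\beta)=\sum_{\emptyset\le v\le w}(-1)^{|w|-|v|}\Upsilon_{\mathrm{perm}(v)}(\beta)$, the sum over all subwords of $w$ (one for each subset of positions); equivalently $c_\emptyset(\beta)=1$ and $c_w(\beta)=\Upsilon_w(\beta)-\sum_{v\in S_m,\,0\le m<n}c_v(\beta)p_v(w)$. *)

(* Defs.v *)
From HB Require Import structures.
From mathcomp Require Import all_boot all_order all_algebra.
From mathcomp Require Import mpoly.
From Stdlib Require Import ClassicalEpsilon.
Set Implicit Arguments. Unset Strict Implicit. Unset Printing Implicit Defensive.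
Import Order.TTheory GRing.Theory Num.Theory.
Local Open Scope ring_scope.

Notation Zb := {poly int}.
Definition beta : Zb := 'X.

(* x_{j+1} as a polynomial in n variables (0-based index j); 0 if out of range *)
Definition xvar (n : nat) (j : nat) : {mpoly Zb[n]} :=
  if insub j is Some k then 'X_k else 0.

Definition swapidx (i j : nat) : nat :=
  if j == i then i.+1 else if j == i.+1 then i else j.

Definition sact (n i : nat) (f : {mpoly Zb[n]}) : {mpoly Zb[n]} :=
  f \mPo [tuple xvar n (swapidx i j) | j < n].

(* divided difference: the (unique) g with (x_i - x_{i+1}) g = f - s_i f *)
Definition ddiff (n i : nat) (f : {mpoly Zb[n]}) : {mpoly Zb[n]} :=
  epsilon (inhabits 0)
    (fun g => (xvar n i - xvar n i.+1) * g = f - sact i f).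

Definition piop (n i : nat) (f : {mpoly Zb[n]}) : {mpoly Zb[n]} :=
  ddiff i ((1 + beta%:MP * xvar n i.+1) * f).

Definition is_perm (w : seq nat) : bool := perm_eq w (iota 1 (size w)).

Definition longest (n : nat) : seq nat := rev (iota 1 n).

Definition swap_pos (w : seq nat) (i : nat) : seq nat :=
  set_nth 0 (set_nth 0 w i (nth 0 w i.+1)) i.+1 (nth 0 w i).

Definition first_ascent (w : seq nat) : nat :=
  find (fun j => (nth 0 w j < nth 0 w j.+1)%N) (iota 0 (size w).-1).

Definition top_monomial (n : nat) : {mpoly Zb[n]} :=
  \prod_(i < n) 'X_i ^+ (n - 1 - i)%N.

(* beta-Grothendieck polynomials via the defining recursion, using
   the first ascent (the result is independent of choices); the fuel
   'C(n,2) suffices since each step increases the inversion number. *)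
Fixpoint groth_aux (n : nat) (fuel : nat) (w : seq nat) : {mpoly Zb[n]} :=
  if w == longest n then top_monomial n else
  match fuel with
  | 0 => 0
  | k.+1 => piop (first_ascent w) (groth_aux n k (swap_pos w (first_ascent w)))
  end.

Definition groth (w : seq nat) : {mpoly Zb[size w]} :=
  groth_aux (size w) 'C(size w, 2) w.

Definition upsilon (w : seq nat) : Zb := (groth w).@[fun _ => 1].

Definition std (v : seq nat) : seq nat :=
  map (fun x => (count (fun y => (y < x)%N) v).+1) v.

Definition pcount (u w : seq nat) : nat :=
  #|[set m : (size w).-tuple bool | std (mask m w) == u]|.

Definition cpoly (w : seq nat) : Zb :=
  \sum_(m : (size w).-tuple bool)
     (-1) ^+ (size w - size (mask m w))%N * upsilon (std (mask m w)).

(* Main.v *)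
Require Import Defs.
From mathcomp Require Import all_boot all_order all_algebra.
From mathcomp Require Import mpoly ring zify.
From Stdlib Require Import ClassicalEpsilon.
Import GRing.Theory Num.Theory.
Set Implicit Arguments. Unset Strict Implicit. Unset Printing Implicit Defensive.
Local Open Scope ring_scope.

(** In the 0-Hecke algebra ([T_i ^ 2 = beta T_i]) the Grothendieck polynomials are the
    coefficients of a product of factors [1 + x_j T_i], read column by column (Fomin and
    Kirillov); the Yang-Baxter relation turns this product into the recursion by [pi_i].
    At [x = 1], peeling off one column expresses the specialization at [w = L m s], [m]
    the minimum, as a sum over rearrangements of [L s], produced by a sweep of [s] from
    right to left that moves a carried letter [c] to the left past larger letters.

    For the inclusion-exclusion, let [c_{w,P}] be the alternating sum over those subwords
    of [w] that contain a set [P] of marked letters.  If in every occurrence of 1423 in [w]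
    the letter playing 2 is marked, then [c_{w,P}] has nonnegative coefficients: the sweep
    expands it into sums of the same kind for words with one letter less, where all letters
    that have been carried are marked.  The only negative terms would come from carrying [c]
    past the place of a missing smaller letter [a] to reach some [z > c]; but then [m z a c]
    is an occurrence of 1423, so [a] is marked and cannot be missing.  Moving a marked [c]
    to the left past larger letters preserves the hypothesis. *)

(** * Adjacent swaps of letters in a word *)

Lemma split2 (i : nat) (w : seq nat) : (i.+1 < size w)%N ->
  exists u a b v, w = u ++ a :: b :: v /\ size u = i.
Proof.
move=> iw; exists (take i w), (nth 0%N w i), (nth 0%N w i.+1), (drop i.+2 w).
have iw' : (i < size w)%N by apply: ltnW.
by rewrite -drop_nth // -drop_nth // cat_take_drop size_take iw'.
Qed.

Lemma swap_pos_cat u a c v :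
  swap_pos (u ++ a :: c :: v) (size u) = u ++ c :: a :: v.
Proof. by rewrite /swap_pos; elim: u => [|d u IH] //=; rewrite IH. Qed.

Lemma nth_cat0 (u : seq nat) a v : nth 0%N (u ++ a :: v) (size u) = a.
Proof. by rewrite nth_cat ltnn subnn. Qed.

Lemma nth_cat1 (u : seq nat) a c v : nth 0%N (u ++ a :: c :: v) (size u).+1 = c.
Proof. by rewrite -cat_rcons -(size_rcons u a) nth_cat0. Qed.

Lemma perm_swap_pos w i : (i.+1 < size w)%N -> perm_eq (swap_pos w i) w.
Proof.
case/split2=> u [a [c [v [-> <-]]]]; rewrite swap_pos_cat perm_cat2l.
by rewrite (perm_catCA [:: c] [:: a]).
Qed.

(** * Coefficients of products of factors [1 + y T_i] in the 0-Hecke algebra *)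

Section Column.

Variables (R : comNzRingType) (b : R).
Implicit Types (x : nat -> R) (F G : seq nat -> R) (p s w : seq nat).

(* Coefficient of [T_w] in [(\sum_v F v T_v) (1 + y T_i)], where [T_i ^ 2 = b T_i]. *)
Definition hop i (y : R) F w : R :=
  F w + (if (nth 0 w i.+1 < nth 0 w i)%N
         then y * (F (swap_pos w i) + b * F w) else 0).

Fixpoint hops x k F : seq nat -> R :=
  if k is k'.+1 then hop k' (x k') (hops x k' F) else F.

(* The embedding of permutations [u |-> 1 x u] on coefficients. *)
Definition headmin F w : R :=
  if w is c :: s then (if all (ltn c) s then F s else 0) else 0.

(** A sum over pipe dreams with row weights [x]: the outer [hops] is the first column, and [headmin]
    shifts the generators of the other columns. *)
Fixpoint pdsum x n : seq nat -> R :=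
  if n is n'.+1 then hops x n' (headmin (pdsum x n')) else fun=> 1.

(* [(1 + b y)] times the inverse of [hop i y] *)
Definition kop i (y : R) F w : R :=
  (1 + b * y) * F w - (if (nth 0 w i.+1 < nth 0 w i)%N
         then y * (F (swap_pos w i) + b * F w) else 0).

Definition eq_on n F G := forall w, size w = n -> uniq w -> F w = G w.

Lemma eq_on_trans n F G H : eq_on n F G -> eq_on n G H -> eq_on n F H.
Proof. by move=> FG GH w sw uw; rewrite FG ?GH. Qed.

Lemma eq_on_sym n F G : eq_on n F G -> eq_on n G F.
Proof. by move=> FG w sw uw; rewrite FG. Qed.

Lemma hopE u a c v y F :
  hop (size u) y F (u ++ a :: c :: v) = F (u ++ a :: c :: v) +
    if (c < a)%N then y * (F (u ++ c :: a :: v) + b * F (u ++ a :: c :: v)) else 0.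
Proof. by rewrite /hop swap_pos_cat nth_cat0 nth_cat1. Qed.

Lemma kopE u a c v y F :
  kop (size u) y F (u ++ a :: c :: v) = (1 + b * y) * F (u ++ a :: c :: v) -
    if (c < a)%N then y * (F (u ++ c :: a :: v) + b * F (u ++ a :: c :: v)) else 0.
Proof. by rewrite /kop swap_pos_cat nth_cat0 nth_cat1. Qed.

Lemma hop_eq_on n i y F G : (i.+1 < n)%N ->
  eq_on n F G -> eq_on n (hop i y F) (hop i y G).
Proof.
move=> ltin FG w sw uw; have pw := @perm_swap_pos w i; rewrite sw in pw.
rewrite /hop !FG //; first by rewrite (perm_size (pw ltin)).
by rewrite (perm_uniq (pw ltin)).
Qed.

Lemma kop_eq_on n i y F G : (i.+1 < n)%N ->
  eq_on n F G -> eq_on n (kop i y F) (kop i y G).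
Proof.
move=> ltin FG w sw uw; have pw := @perm_swap_pos w i; rewrite sw in pw.
rewrite /kop !FG //; first by rewrite (perm_size (pw ltin)).
by rewrite (perm_uniq (pw ltin)).
Qed.

Lemma hops_eq_on n x k F G : (k < n)%N ->
  eq_on n F G -> eq_on n (hops x k F) (hops x k G).
Proof.
by elim: k => [|k IH] //= ltkn FG; apply: hop_eq_on => //; apply: IH => //; apply: ltnW.
Qed.

Lemma eq_hops x x' k F : (forall j, (j < k)%N -> x j = x' j) ->
  hops x k F = hops x' k F.
Proof.
elim: k => [|k IH] //= xx'; rewrite xx' // IH // => j jk.
by apply: xx'; apply: ltnW.
Qed.

Lemma eq_pdsum x x' n : (forall j, (j.+1 < n)%N -> x j = x' j) ->
  pdsum x n = pdsum x' n.
Proof.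
elim: n => [|n IH] //= xx'; rewrite (eq_hops (x' := x')); last by move=> j jn; apply: xx'.
by rewrite IH // => j jn; apply: xx'; apply: ltnW.
Qed.

Lemma hop_scale i y (d : R) F w :
  hop i y (fun t => d * F t) w = d * hop i y F w.
Proof. by rewrite /hop; case: ifP => _; ring. Qed.

(** [(1 + y T_i) (1 + b y - y T_i) = 1 + b y], because [T_i ^ 2 = b T_i]. *)
Lemma hop_kopK n i y F : (i.+1 < n)%N ->
  eq_on n (kop i y (hop i y F)) (fun w => (1 + b * y) * F w).
Proof.
move=> ltin w sw uw; rewrite -sw in ltin.
case: (split2 ltin) uw => u [a [c [v [-> <-]]]].
rewrite cat_uniq /= inE => /and3P[_ _ /and3P[/norP[neq_ac _] _ _]].
rewrite kopE !hopE; case: (ltngtP a c) neq_ac => // _ _; ring.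
Qed.

Lemma hop_same n i y z F : (i.+1 < n)%N ->
  eq_on n (hop i y (hop i z F)) (hop i z (hop i y F)).
Proof.
move=> ltin w sw uw; rewrite -sw in ltin.
case: (split2 ltin) uw => u [a [c [v [-> <-]]]].
rewrite cat_uniq /= inE => /and3P[_ _ /and3P[/norP[neq_ac _] _ _]].
rewrite !hopE; case: (ltngtP a c) neq_ac => // _ _; ring.
Qed.

Lemma hop_far n i j y z F : (i.+1 < j)%N -> (j.+1 < n)%N ->
  eq_on n (hop i y (hop j z F)) (hop j z (hop i y F)).
Proof.
move=> ltij ltjn w sw uw; rewrite -sw in ltjn.
case: (split2 ltjn) uw => u' [d [e [t [-> su']]]] _.
have ltiu : (i.+1 < size u')%N by rewrite su'.
case: (split2 ltiu) su' => u [a [c [v [-> <-]]]] <-.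
have hj F' a' c' d' e' : hop (size (u ++ a :: c :: v)) z F'
    ((u ++ a' :: c' :: v) ++ d' :: e' :: t) = F' ((u ++ a' :: c' :: v) ++ d' :: e' :: t) +
      if (e' < d')%N then z * (F' ((u ++ a' :: c' :: v) ++ e' :: d' :: t) +
        b * F' ((u ++ a' :: c' :: v) ++ d' :: e' :: t)) else 0.
  by rewrite -hopE !size_cat.
have hi F' a' c' d' e' : hop (size u) y F'
    ((u ++ a' :: c' :: v) ++ d' :: e' :: t) = F' ((u ++ a' :: c' :: v) ++ d' :: e' :: t) +
      if (c' < a')%N then y * (F' ((u ++ c' :: a' :: v) ++ d' :: e' :: t) +
        b * F' ((u ++ a' :: c' :: v) ++ d' :: e' :: t)) else 0.
  by rewrite -!catA /= hopE.
rewrite hi !hj !hi; case: (e < d)%N; case: (c < a)%N; ring.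
Qed.

Lemma hops_far n x i j y F : (i < j)%N -> (j.+1 < n)%N ->
  eq_on n (hop j y (hops x i F)) (hops x i (hop j y F)).
Proof.
elim: i => [|i IH] //= ltij ltjn.
apply: eq_on_trans (eq_on_sym (hop_far _ _ _ ltij ltjn)) _.
apply: hop_eq_on; first by lia.
by apply: IH => //; apply: ltnW.
Qed.

Lemma hop_headmin n i y F : (i.+1 < n)%N ->
  eq_on n.+1 (hop i.+1 y (headmin F)) (headmin (hop i y F)).
Proof.
move=> ltin [|a w] //= [sw] _; rewrite -sw in ltin.
rewrite /hop /= (perm_all _ (perm_swap_pos ltin)).
by case: ifP => // _; case: ifP => // _; rewrite !(mulr0, addr0).
Qed.

Lemma headmin_eq_on n F G : eq_on n F G -> eq_on n.+1 (headmin F) (headmin G).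
Proof. by move=> FG [|a w] //= [sw] /andP[_ uw]; rewrite FG. Qed.

(* The Yang-Baxter relation: [h2(y)^-1 h1(x) h2(y) h1(y)] is symmetric in [x], [y]. *)
Lemma hop_braid n i y z F : (i.+2 < n)%N ->
  eq_on n
    (fun w => (1 + b * z) * hop i y (hop i.+1 y (hop i z (kop i.+1 y F))) w)
    (fun w => (1 + b * y) * hop i z (hop i.+1 z (hop i y (kop i.+1 z F))) w).
Proof.
move=> ltin w sw uw; rewrite -sw in ltin.
have [u [a [c [v [ew ei]]]]] := split2 (ltnW ltin).
move: ltin uw; rewrite {}ew -{}ei; case: v => [|d v].
  by rewrite size_cat /= addn2 ltnn.
move=> _; rewrite cat_uniq /= !inE.
move=> /and4P[_ _ /norP[nac /norP[nad _]] /andP[/norP[ncd _] _]].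
have hi F' y' a' c' d' : hop (size u).+1 y' F' (u ++ a' :: c' :: d' :: v) =
    F' (u ++ a' :: c' :: d' :: v) +
    if (d' < c')%N then y' * (F' (u ++ a' :: d' :: c' :: v) +
        b * F' (u ++ a' :: c' :: d' :: v)) else 0.
  by rewrite -(size_rcons u a') -!(cat_rcons a') hopE.
have ki F' y' a' c' d' : kop (size u).+1 y' F' (u ++ a' :: c' :: d' :: v) =
    (1 + b * y') * F' (u ++ a' :: c' :: d' :: v) -
    if (d' < c')%N then y' * (F' (u ++ a' :: d' :: c' :: v) +
        b * F' (u ++ a' :: c' :: d' :: v)) else 0.
  by rewrite -(size_rcons u a') -!(cat_rcons a') kopE.
rewrite !hopE !hi !hopE !ki.
(* Only the six values of [F] at the rearrangements of [a], [c], [d] occur; for each order of these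
   letters the claim is a polynomial identity. *)
move: {hi ki}(F _) (F _) (F _) (F _) (F _) (F _) => f1 f2 f3 f4 f5 f6.
case: (ltngtP a c) nac => // ac _; case: (ltngtP a d) nad => // ad _;
  case: (ltngtP c d) ncd => // cd _; try (exfalso; lia); ring.
Qed.

End Column.

(** * Exchange of two adjacent variables *)

Lemma swapidx_out i j : j != i -> j != i.+1 -> swapidx i j = j.
Proof. by rewrite /swapidx => /negbTE-> /negbTE->. Qed.

Lemma swapidx_l i : swapidx i i = i.+1.
Proof. by rewrite /swapidx eqxx. Qed.

Lemma swapidx_r i : swapidx i i.+1 = i.
Proof. by rewrite /swapidx eqxx eqn_leq ltnn. Qed.

Section Symmetry.

Variables (R : idomainType) (b : R).

(** Write [h_i(y) = 1 + y T_i], with primes for swapped variables. By induction the product [Q] of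
    all factors before [h_i(z) h_{i+1}(y)] satisfies [Q h_{i+1}(y) = Q' h_{i+1}(z)]. Writing [Q] as
    [Q h_{i+1}(y) h_{i+1}(y)^-1] reduces the claim to the braid relation. *)
Lemma pdsum_sym n (x : nat -> R) i :
  (forall j, 1 + b * x j != 0) -> (i.+1 < n)%N ->
  eq_on n (hop b i (x i.+1) (pdsum b x n))
          (hop b i (x i) (pdsum b (x \o swapidx i) n)).
Proof.
move=> nzx; elim: n i => [|n IH] i //; rewrite ltnS => ltin.
set x' := x \o swapidx i; pose y := x i.+1; pose z := x i.
have x'_lt j : (j < i)%N -> x j = x' j.
  by move=> ltji; rewrite /x' /= swapidx_out //; lia.
have x'_gt j : (i.+1 < j)%N -> x j = x' j.
  by move=> ltji; rewrite /x' /= swapidx_out //; lia.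
have x'i : x' i = y by rewrite /x' /= swapidx_l.
have x'i1 : x' i.+1 = z by rewrite /x' /= swapidx_r.
rewrite -/y -/z /=; set F := headmin (pdsum b x n); set F' := headmin (pdsum b x' n).
(* If [i.+1 = n], the first column ends with its factor at [i], and the other columns involve
   neither [x i] nor [x i.+1]. *)
have [eq_in|lt_in] : i.+1 = n \/ (i.+1 < n)%N by lia.
  subst n.
  have -> : F' = F by rewrite /F /F' (@eq_pdsum _ _ x x').
  rewrite /= -(eq_hops _ _ x'_lt) x'i -/z.
  exact: hop_same.
pose Q := hops b x i F; pose Q' := hops b x' i F'.
have QS : eq_on n.+1 (hop b i.+1 y Q) (hop b i.+1 z Q').
  apply: eq_on_trans (hops_far _ _ _ _ _ _) _ => //.
  apply: eq_on_sym; apply: eq_on_trans (hops_far _ _ _ _ _ _) _ => //.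
  rewrite -(eq_hops _ _ x'_lt); apply: eq_on_sym; apply: hops_eq_on; first by lia.
  apply: eq_on_trans (hop_headmin _ _ _ _) _ => //.
  apply: eq_on_sym; apply: eq_on_trans (hop_headmin _ _ _ _) _ => //.
  by apply: eq_on_sym; apply: headmin_eq_on; apply: IH.
have base : eq_on n.+1 (hop b i y (hops b x i.+2 F)) (hop b i z (hops b x' i.+2 F')).
  rewrite /= x'i x'i1 -/y -/z -/Q -/Q' => w sw uw.
  have scale3 (d y1 y2 : R) G K : eq_on n.+1 (fun t => d * G t) K ->
      eq_on n.+1 (fun t => d * hop b i y1 (hop b i.+1 y1 (hop b i y2 G)) t)
                 (hop b i y1 (hop b i.+1 y1 (hop b i y2 K))).
    have scale k y3 G1 K1 : (k.+1 < n.+1)%N -> eq_on n.+1 (fun t => d * G1 t) K1 ->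
        eq_on n.+1 (fun t => d * hop b k y3 G1 t) (hop b k y3 K1).
      by move=> lek GK t st ut; rewrite -hop_scale; apply: (hop_eq_on _ _ _ GK).
    by move=> GK; do 3!apply: (scale) => //.
  (* [kop] inverts [hop] only up to the scalars [1 + b y] and [1 + b z], so the equation is
     multiplied by both. *)
  apply: (mulfI (nzx i)); apply: (mulfI (nzx i.+1)); rewrite -/y -/z.
  have e1 : eq_on n.+1 (fun t => (1 + b * y) * Q t) (kop b i.+1 y (hop b i.+1 y Q)).
    by apply: eq_on_sym; apply: hop_kopK.
  have e2 : eq_on n.+1 (fun t => (1 + b * z) * Q' t) (kop b i.+1 z (hop b i.+1 y Q)).
    apply: eq_on_sym; apply: eq_on_trans (kop_eq_on _ _ _ QS) _ => //.
    exact: hop_kopK.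
  rewrite mulrCA (scale3 _ _ _ _ _ e1) // (scale3 _ _ _ _ _ e2) //.
  exact: (@hop_braid _ b n.+1).
(* The factors of the column beyond [i.+1] commute with [T_i]. *)
have claim d : (i.+2 + d <= n)%N ->
    eq_on n.+1 (hop b i y (hops b x (i.+2 + d) F)) (hop b i z (hops b x' (i.+2 + d) F')).
  elim: d => [|d IHd] led; first by rewrite addn0.
  rewrite addnS in led *.
  apply: eq_on_trans (hop_far _ _ _ _ _ _) _; [by lia | by lia |].
  apply: eq_on_sym.
  apply: eq_on_trans (hop_far _ _ _ _ _ _) _; [by lia | by lia |].
  rewrite -x'_gt; last by lia.
  apply: eq_on_sym; apply: hop_eq_on; first by lia.
  by apply: IHd; lia.
by have := claim (n - i.+2)%N; rewrite subnKC //; apply.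
Qed.

(** Compares coefficients in [pdsum_sym]: at [w], an ascent, the swap of variables changes nothing;
    with this, the coefficient at [swap_pos w i] gives the formula. *)
Lemma pdsum_ddiff n (x : nat -> R) i w :
  (forall j, 1 + b * x j != 0) -> (i.+1 < n)%N -> size w = n -> uniq w ->
  (nth 0 w i < nth 0 w i.+1)%N ->
  (x i - x i.+1) * pdsum b x n w =
    (1 + b * x i.+1) * pdsum b x n (swap_pos w i) -
    (1 + b * x i) * pdsum b (x \o swapidx i) n (swap_pos w i).
Proof.
move=> nzx ltin sw uw; have sym := pdsum_sym nzx ltin.
have ltiw : (i.+1 < size w)%N by rewrite sw.
have := sym (swap_pos w i); have := sym w sw uw.
rewrite (perm_uniq (perm_swap_pos ltiw)) (perm_size (perm_swap_pos ltiw)) sw => + /(_ erefl uw).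
have [u [a [c [v [ew ei]]]]] := split2 ltiw; rewrite {}ew -{}ei.
rewrite swap_pos_cat nth_cat0 nth_cat1 !hopE => + + ltac.
rewrite ltac ltnNge (ltnW ltac) /= !addr0 => e1.
rewrite -{}e1.
set f1 := pdsum b x n (u ++ a :: c :: v); set f2 := pdsum b x n _; set f3 := pdsum _ _ _ _ => e2.
have -> : (1 + b * x (size u)) * f3 =
  f3 + x (size u) * (f1 + b * f3) - x (size u) * f1 by ring.
rewrite -e2; ring.
Qed.

End Symmetry.

(** * One column read from right to left *)

Section Scan.

Variables (R : comNzRingType) (b : R).
Implicit Types (x : nat -> R) (F G : seq nat -> R) (p s w : seq nat).

(* [hops] unfolded from right to left; the letters of [p] are in reverse order. *)
Fixpoint scan x F p c s : R :=
  if p is a :: p' then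
    scan x F p' a (c :: s) +
    if (c < a)%N then x (size p') * (scan x F p' c (a :: s) + b * scan x F p' a (c :: s))
    else 0
  else F (c :: s).

Lemma hops_scan x F p c s : hops b x (size p) F (rev p ++ c :: s) = scan x F p c s.
Proof.
elim: p c s => [|a p IH] c s //=.
rewrite rev_cons cat_rcons -[X in hop b X](size_rev p) hopE.
by rewrite -!IH.
Qed.

Lemma pdsum_scan x p c :
  pdsum b x (size p).+1 (rev (c :: p)) = scan x (headmin (pdsum b x (size p))) p c [::].
Proof. by rewrite rev_cons -cats1 -hops_scan. Qed.

(** A letter put into the suffix never returns to the front, where [headmin] requires the
    minimum. *)
Lemma scan_min_suffix x F p c s m : m \in s -> all (leq m) (c :: p) ->
  scan x (headmin F) p c s = 0.
Proof.
elim: p c s => [|a p IH] c s ms /=; rewrite ?andbT.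
  move=> lemc; case: allP => // /(_ m ms) /=; lia.
case/and3P => lemc lema lemp.
rewrite !IH ?inE ?ms ?orbT //= ?lema ?lemc //.
by case: ifP => _; ring.
Qed.

(** The minimum must be carried to the front past every letter of [p], since all other terms vanish
    by [scan_min_suffix]; each passage costs one variable. *)
Lemma scan_min x F p s m : all (ltn m) p -> all (ltn m) s ->
  scan x (headmin F) p m s = (\prod_(j < size p) x j) * F (rev p ++ s).
Proof.
elim: p s => [|a p IH] s /=; first by move=> _ ->; rewrite big_ord0 mul1r.
case/andP => ltma ltmp ltms; have lemp : all (leq m) p.
  by apply: sub_all ltmp => j; apply: ltnW.
rewrite ltma IH //=; last by rewrite ltma.
rewrite (scan_min_suffix _ _ (m := m)) ?inE ?eqxx //=; last by rewrite ltnW.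
by rewrite big_ord_recr /= rev_cons cat_rcons; ring.
Qed.

Lemma pdsum_decreasing x p :
  sorted ltn p -> pdsum b x (size p) (rev p) = \prod_(i < size p) x i ^+ (size p - 1 - i).
Proof.
elim: p => [|m p IH]; first by rewrite big_ord0.
move=> srt; rewrite [size _]/= pdsum_scan scan_min //; last exact: order_path_min ltn_trans srt.
rewrite cats0 IH; last exact: path_sorted srt.
rewrite big_ord_recr /=.
have -> : ((size p).+1 - 1 - size p = 0)%N by lia.
rewrite expr0 mulr1 -big_split /=.
apply: eq_bigr => i _; rewrite -exprS; congr (_ ^+ _).
by have := ltn_ord i; lia.
Qed.

Lemma hops_map x n (D : pred nat) (f : nat -> nat) k F G :
  {in D &, {mono f : a c / (a < c)%N}} -> (k < n)%N ->
  (forall t, size t = n -> all D t -> G (map f t) = F t) ->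
  forall t, size t = n -> all D t -> hops b x k G (map f t) = hops b x k F t.
Proof.
move=> fD; elim: k => [|k IH] //= ltkn GF t st Dt; have {}IH := IH (ltnW ltkn) GF.
have : (k.+1 < size t)%N by rewrite st.
case/split2 => u [a [c [v [et ku]]]]; move: st Dt; rewrite {}et -{}ku in IH * => st Dt.
have Dt' : all D (u ++ c :: a :: v).
  by move: Dt; rewrite !all_cat /= => /and4P[-> -> -> ->].
have st' : size (u ++ c :: a :: v) = n by rewrite -st !size_cat.
have [Da Dc] : D a /\ D c by move: Dt; rewrite all_cat /= => /and4P[].
rewrite hopE map_cat /= -[X in hop b X](size_map f u) hopE fD //.
by rewrite -(IH _ st Dt) -(IH _ st' Dt') !map_cat.
Qed.

(** Only comparisons of letters matter; so subwords can be treated without standardizing them. *)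
Lemma pdsum_map x n (D : pred nat) (f : nat -> nat) w :
  {in D &, {mono f : a c / (a < c)%N}} -> all D w -> size w = n ->
  pdsum b x n (map f w) = pdsum b x n w.
Proof.
move=> fD; elim: n w => [|n IH] w Dw sw //=.
apply: (hops_map _ fD _ _ sw Dw) => // {sw Dw}w sw Dw.
case: w sw Dw => [|a t] //= [st] /andP[Da Dt]; rewrite all_map.
have -> : all (preim f (ltn (f a))) t = all (ltn a) t.
  by apply: eq_in_all => c ct /=; rewrite fD //; apply: (allP Dt).
by rewrite IH.
Qed.

End Scan.

(** * Identification with the Grothendieck polynomials *)

Lemma pdsum_rmorph (R S : comNzRingType) (phi : {rmorphism R -> S}) b x n w :
  phi (pdsum b x n w) = pdsum (phi b) (phi \o x) n w.
Proof.
have hphi k F G : (forall t, phi (F t) = G t) ->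
    forall t, phi (hops b x k F t) = hops (phi b) (phi \o x) k G t.
  elim: k => [|k IH] //= FG t; have {}IH := IH FG.
  by rewrite /hop; case: ifP => _; rewrite ?rmorphD ?rmorphM ?rmorphD ?rmorphM ?rmorph0 !IH.
elim: n w => [|n IH] w /=; first by rewrite rmorph1.
apply: hphi => -[|a t] /=; first by rewrite rmorph0.
by case: ifP; rewrite ?IH ?rmorph0.
Qed.

Lemma xvarE n (i : 'I_n) : xvar n i = 'X_i.
Proof. by rewrite /xvar insubT ?ltn_ord // => lt; congr ('X_ _); apply: val_inj. Qed.

Lemma xvar_out n j : (n <= j)%N -> xvar n j = 0.
Proof. by move=> lenj; rewrite /xvar insubF // ltnNge lenj. Qed.

Lemma sact_xvar n i j : (i.+1 < n)%N -> sact i (xvar n j) = xvar n (swapidx i j).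
Proof.
move=> ltin; case: (ltnP j n) => [ltjn|lenj].
  by rewrite (xvarE (Ordinal ltjn)) /sact comp_mpolyXU -tnth_nth tnth_mktuple.
by rewrite swapidx_out ?xvar_out // /sact ?comp_mpoly0 ?raddf0 //; lia.
Qed.

Lemma xvar_beta_neq0 n j : 1 + beta%:MP * xvar n j != 0.
Proof.
case: (ltnP j n) => [ltjn|lenj]; last by rewrite xvar_out // mulr0 addr0 oner_neq0.
rewrite (xvarE (Ordinal ltjn)); apply/eqP => /(congr1 (meval (fun=> 0))).
by rewrite rmorphD rmorphM rmorph1 /= mevalXU mulr0 addr0 raddf0 => /eqP; rewrite oner_eq0.
Qed.

Lemma xvar_sub_neq0 n i : (i.+1 < n)%N -> xvar n i - xvar n i.+1 != 0.
Proof.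
move=> ltin; have ltin' := ltnW ltin.
rewrite (xvarE (Ordinal ltin')) (xvarE (Ordinal ltin)).
apply/eqP => /(congr1 (meval (fun j : 'I_n => if j == i :> nat then 1 else 0))).
rewrite rmorphB /= !mevalXU raddf0 /= eqxx.
by rewrite eqn_leq ltnn /= subr0 => /eqP; rewrite oner_eq0.
Qed.

Lemma piop_pdsum n i w : (i.+1 < n)%N -> size w = n -> uniq w ->
  (nth 0 w i < nth 0 w i.+1)%N ->
  piop i (pdsum beta%:MP (xvar n) n (swap_pos w i)) = pdsum beta%:MP (xvar n) n w.
Proof.
move=> ltin sw uw asc; have nzx := @xvar_beta_neq0 n.
have rec := pdsum_ddiff nzx ltin sw uw asc.
have sactP t : sact i (pdsum beta%:MP (xvar n) n t) =
    pdsum beta%:MP (xvar n \o swapidx i) n t.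
  rewrite /sact (pdsum_rmorph (comp_mpoly _)) /= comp_mpolyC.
  by rewrite (@eq_pdsum _ _ _ (xvar n \o swapidx i)) // => j _; apply: sact_xvar.
rewrite /piop /ddiff; set f := _ * pdsum _ _ _ _.
have ef : (xvar n i - xvar n i.+1) * pdsum beta%:MP (xvar n) n w = f - sact i f.
  rewrite rec /f; congr (_ - _); rewrite -sactP /sact rmorphM; congr (_ * _).
  by rewrite rmorphD rmorphM rmorph1 /= comp_mpolyC -/(sact i _) sact_xvar // swapidx_r.
(* [pdsum] at [w] shows that a quotient exists; cancelling [x_i - x_{i+1}] identifies it with the
   one chosen by [epsilon]. *)
have := epsilon_spec (inhabits 0)
  (fun g => (xvar n i - xvar n i.+1) * g = f - sact i f) (ex_intro _ _ ef).
rewrite -ef; apply: mulfI; exact: xvar_sub_neq0.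
Qed.

(** Measure for the fuel: it drops with every swap at an ascent. *)
Fixpoint asc_pairs (w : seq nat) : nat :=
  if w is a :: w' then count (ltn a) w' + asc_pairs w' else 0.

Lemma asc_pairs_max w : (asc_pairs w <= 'C(size w, 2))%N.
Proof.
elim: w => [|a w IH] //=; rewrite binS bin1 addnC.
by apply: leq_add IH (count_size _ _).
Qed.

Lemma asc_pairs_swap w i : (i.+1 < size w)%N -> (nth 0 w i < nth 0 w i.+1)%N ->
  (asc_pairs (swap_pos w i) < asc_pairs w)%N.
Proof.
case/split2 => u [a [c [v [-> <-]]]]; rewrite swap_pos_cat nth_cat0 nth_cat1 => ltac.
elim: u => [|d u IH] /=; last by rewrite -addnS leq_add // !count_cat /=; lia.
have -> : (c < a)%N = false by lia.
by rewrite ltac; lia.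
Qed.

Lemma first_ascentP n w : perm_eq w (iota 1 n) -> w != longest n ->
  let i := first_ascent w in (i.+1 < n)%N /\ (nth 0 w i < nth 0 w i.+1)%N.
Proof.
move=> pw neqw; have sw : size w = n by rewrite (perm_size pw) size_iota.
pose asc := fun j => (nth 0 w j < nth 0 w j.+1)%N.
have hasc : has asc (iota 0 (size w).-1).
  apply: contraR neqw => /hasPn noasc; apply/eqP.
  apply: (@sorted_eq _ geq); first by move=> a c d lac lda; apply: leq_trans lda lac.
  - by move=> a c; rewrite andbC; apply: anti_leq.
  - apply/(sortedP 0%N) => j ltj; rewrite /geq /= leqNgt.
    by apply: noasc; rewrite mem_iota; move: ltj; case: size.
  - by rewrite /longest rev_sorted; apply: (iota_sorted 1 n).
  - by rewrite /longest perm_sym perm_rev perm_sym.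
rewrite /first_ascent -/asc -sw; have := hasc; rewrite has_find size_iota => ltf.
split; first by move: ltf; rewrite -ltnS; case: (size w) => [|k] /=; lia.
by have := nth_find 0%N hasc; rewrite nth_iota // add0n.
Qed.

Lemma groth_aux_pdsum n k w : perm_eq w (iota 1 n) -> (asc_pairs w <= k)%N ->
  groth_aux n k w = pdsum beta%:MP (xvar n) n w.
Proof.
have longestE : top_monomial n = pdsum beta%:MP (xvar n) n (longest n).
  have := @pdsum_decreasing _ beta%:MP (xvar n) (iota 1 n).
  rewrite size_iota => ->; last exact: iota_ltn_sorted.
  by apply: eq_bigr => i _; rewrite xvarE subnAC.
elim: k w => [|k IH] w pw lek /=; case: ifPn => [/eqP-> //|/(first_ascentP pw)[ltin asc]].
  (* Without fuel there are no ascending pairs, against the ascent found in a word other than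
     [longest n]. *)
  have := @asc_pairs_swap w (first_ascent w).
  by rewrite (perm_size pw) size_iota ltin asc => /(_ erefl erefl); lia.
have sw : size w = n by rewrite (perm_size pw) size_iota.
have ltiw : ((first_ascent w).+1 < size w)%N by rewrite sw.
rewrite IH; first by apply: piop_pdsum; rewrite // (perm_uniq pw) iota_uniq.
  exact: perm_trans (perm_swap_pos ltiw) pw.
by have := asc_pairs_swap ltiw asc; lia.
Qed.

(** * Principal specialization for words with arbitrary distinct letters *)

Definition pdcount (w : seq nat) : Zb := pdsum beta (fun=> 1) (size w) w.

Lemma upsilon_pdcount w : is_perm w -> upsilon w = pdcount w.
Proof.
move=> pw; rewrite /upsilon /groth groth_aux_pdsum ?asc_pairs_max //.
rewrite (pdsum_rmorph (meval _)) /= mevalC /pdcount.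
rewrite (@eq_pdsum _ _ _ (fun=> 1)) // => j ltj /=.
by rewrite (xvarE (Ordinal (ltnW ltj))) mevalXU.
Qed.

Lemma std_mono (v : seq nat) :
  {in v &, {mono (fun x => (count (fun y => (y < x)%N) v).+1) : a c / (a < c)%N}}.
Proof.
have incr a c : a \in v -> (a < c)%N ->
    (count (fun y => (y < a)%N) v < count (fun y => (y < c)%N) v)%N.
  move=> + ltac; elim: v => //= d v IH; rewrite inE => /predU1P[<-|/IH].
    by rewrite ltnn ltac add0n add1n ltnS; apply: sub_count => y /=; lia.
  have : ((d < a)%N <= (d < c)%N)%N by lia.
  by lia.
move=> a c av cv; rewrite ltnS; case: (ltngtP a c) => [ltac|ltca|->].
- exact: incr.
- by apply/negbTE; rewrite -leqNgt ltnW // incr.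
- by rewrite ltnn.
Qed.

Lemma std_is_perm v : uniq v -> is_perm (std v).
Proof.
move=> uv; have us : uniq (std v).
  rewrite map_inj_in_uniq // => a c av cv eq_ac.
  have := std_mono av cv; have := std_mono cv av; rewrite eq_ac ltnn.
  by case: (ltngtP a c).
have sub : {subset std v <= iota 1 (size (std v))}.
  move=> _ /mapP[a av ->]; rewrite mem_iota size_map add1n !ltnS /=.
  rewrite ltn_neqAle count_size -all_count andbT.
  by apply/allPn; exists a; rewrite ?ltnn.
rewrite /is_perm; apply: uniq_perm; rewrite ?iota_uniq //.
by have [] := uniq_min_size us sub (eq_leq (size_iota _ _)).
Qed.

Lemma upsilon_std v : uniq v -> upsilon (std v) = pdcount v.
Proof.
move=> uv; rewrite upsilon_pdcount ?std_is_perm // /pdcount size_map.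
by apply: pdsum_map (@std_mono v) _ _ => //; apply/allP.
Qed.

(** * Alternating sums over subwords with marked letters *)

Section MarkedSum.

Variable R : comNzRingType.
Implicit Types (P Q : pred nat) (f g : seq nat -> R) (l : seq nat).

(* Alternating sum of [f] over the subwords of [l] that contain all the letters in [P]. *)
Fixpoint msum P f l : R :=
  if l is a :: l' then
    msum P (fun t => f (a :: t)) l' - (if P a then 0 else msum P f l')
  else f [::].

Lemma eq_msum P f g l : (forall t, subseq t l -> f t = g t) -> msum P f l = msum P g l.
Proof.
elim: l f g => [|a l IH] f g fg /=; first by apply: fg.
rewrite (IH _ (fun t => g (a :: t))); last first.
  by move=> t tl; apply: fg; rewrite /= eqxx.
rewrite (IH f g) // => t tl; apply: fg.
exact: subseq_trans tl (subseq_cons _ _).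
Qed.

Lemma eq_in_msum P Q f l : {in l, P =1 Q} -> msum P f l = msum Q f l.
Proof.
elim: l f => [|a l IH] f PQ //=.
have PQ' : {in l, P =1 Q} by move=> c cl; apply: PQ; rewrite inE cl orbT.
by rewrite !IH // PQ // mem_head.
Qed.

Lemma msumD P f g l : msum P (fun t => f t + g t) l = msum P f l + msum P g l.
Proof. by elim: l f g => [|a l IH] f g //=; rewrite !IH; case: ifP => _; ring. Qed.

Lemma msumZ P (d : R) f l : msum P (fun t => d * f t) l = d * msum P f l.
Proof. by elim: l f => [|a l IH] f //=; rewrite !IH; case: ifP => _; ring. Qed.

Lemma msumB P f g l : msum P (fun t => f t - g t) l = msum P f l - msum P g l.
Proof. by elim: l f g => [|a l IH] f g //=; rewrite !IH; case: ifP => _; ring. Qed.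

Lemma msum0 P l : msum P (fun=> 0) l = 0.
Proof. by elim: l => [|a l IH] //=; rewrite !IH; case: ifP => _; rewrite subr0. Qed.

Lemma msum_cat P f l1 l2 :
  msum P f (l1 ++ l2) = msum P (fun t1 => msum P (fun t2 => f (t1 ++ t2)) l2) l1.
Proof. by elim: l1 f => [|a l1 IH] f //=; rewrite !IH. Qed.

Lemma msum_all P f l : all P l -> msum P f l = f l.
Proof. by elim: l f => [|a l IH] f //= /andP[-> /IH->]; rewrite subr0. Qed.

Lemma msum_rev P f l : msum P f (rev l) = msum P (f \o rev) l.
Proof.
elim: l f => [|a l IH] f //=; rewrite rev_cons -cats1 msum_cat /= msumB.
congr (_ - _); first by rewrite IH; apply: eq_msum => t _ /=; rewrite rev_cons cats1.
case: ifP => _; first by rewrite msum0.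
by rewrite -IH; apply: eq_msum => t _; rewrite cats0.
Qed.

Lemma exchange_msum P (f : seq nat -> seq nat -> R) l1 l2 :
  msum P (fun t1 => msum P (f t1) l2) l1 = msum P (fun t2 => msum P (f^~ t2) l1) l2.
Proof.
elim: l1 f => [|a l1 IH] f //=; rewrite (IH (fun t1 => f (a :: t1))) IH msumB.
by case: ifP => _; rewrite ?msum0.
Qed.

Lemma msum_mask f l :
  msum pred0 f l =
  \sum_(m : (size l).-tuple bool) (-1) ^+ (size l - size (mask m l)) * f (mask m l).
Proof.
elim: l f => [|a l IH] f /=.
  rewrite (big_pred1 [tuple]); first by rewrite mul1r.
  by move=> m; apply/esym/eqP/tuple0.
pose tcons (p : bool * (size l).-tuple bool) := cons_tuple p.1 p.2.
have tconsK : bijective tcons.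
  exists (fun t => (thead t, behead_tuple t)) => [[c t]|t].
    by congr pair; apply: val_inj.
  by case/tupleP: t => c t; apply: val_inj.
rewrite (reindex tcons) /=; last exact: onW_bij.
pose F c (t : (size l).-tuple bool) := (-1) ^+ ((size l).+1 - size (mask (c :: t) (a :: l)))
  * f (mask (c :: t) (a :: l)) : R.
rewrite -(pair_bigA _ F) big_bool /= !IH -sumrN; congr (_ + _).
apply: eq_bigr => t _; rewrite /F /= subSn ?exprS ?mulN1r ?mulNr //.
by rewrite size_mask ?size_tuple // -[X in (_ <= X)%N](size_tuple t) count_size.
Qed.

End MarkedSum.

(** * Peeling off one column at [x = 1] *)

Section Sweep.

Variables (R : comNzRingType) (b : R).
Implicit Types (g h : seq nat -> R) (p s : seq nat) (oc : option nat).

(* With [Some c], the carried letter [c] has to pass at least one more larger letter;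
   with [None], no letter is committed to move. *)
Fixpoint sweep g p oc s : R :=
  match p, oc with
  | [::], None => g s
  | [::], Some _ => 0
  | a :: p', None => sweep g p' None (a :: s) + sweep g p' (Some a) s
  | a :: p', Some c =>
      if (c < a)%N then
        sweep g p' None [:: c, a & s] + sweep g p' (Some c) (a :: s) +
        b * (sweep g p' None [:: a, c & s] + sweep g p' (Some a) (c :: s))
      else 0
  end.

Lemma eq_sweep g h p oc s :
  (forall t, size t = size p + size s + oc -> g t = h t)%N ->
  sweep g p oc s = sweep h p oc s.
Proof.
elim: p oc s => [|a p IH] [c|] s gh //=; first by apply: gh; rewrite addn0.
  case: ifP => // _; rewrite !IH // => t st; apply: gh; move: st => /=; lia.
by rewrite !IH // => t st; apply: gh; move: st => /=; lia.
Qed.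

Lemma msum_sweep P (h : seq nat -> seq nat -> R) p oc s l :
  msum P (fun u => sweep (h u) p oc s) l =
  sweep (fun t => msum P (h^~ t) l) p oc s.
Proof.
elim: p oc s => [|a p IH] [c|] s //=; rewrite ?msum0 //; last by rewrite msumD !IH.
by case: ifP => _; rewrite ?msum0 // !(msumD, msumZ) !IH.
Qed.

Lemma scan_sweep F p c s L m :
  all (ltn m) (c :: p) -> all (ltn m) s -> all (ltn m) L ->
  scan b (fun=> 1) (headmin F) (p ++ m :: rev L) c s =
  let g t := F (L ++ t) in sweep g p None (c :: s) + sweep g p (Some c) s.
Proof.
move=> + + ltmL; elim: p c s => [|a p IH] c s /=.
  (* [c] cannot pass [m]; then [m] is carried to the front past all of [L], with weight 1. *)
  rewrite andbT => ltmc ltms; rewrite ltnNge ltnW //= scan_min /= ?all_rev ?ltmc //.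
  by rewrite big1 // mul1r revK.
case/and3P => ltmc ltma ltmp ltms; rewrite !IH /= ?ltmc ?ltma //.
by case: ifP => _; ring.
Qed.

End Sweep.

Lemma pdcount_sweep L m s : all (ltn m) (L ++ s) ->
  pdcount (L ++ m :: s) = sweep beta (fun t => pdcount (L ++ t)) (rev s) None [::].
Proof.
rewrite all_cat => /andP[ltmL ltms]; pose n := size (L ++ s).
have -> : pdcount (L ++ m :: s) = pdsum beta (fun=> 1) n.+1 (L ++ m :: s).
  by rewrite /pdcount /n !size_cat addnS.
rewrite (@eq_sweep _ _ _ (fun t => pdsum beta (fun=> 1) n (L ++ t))); last first.
  move=> t; rewrite size_rev /= !addn0 => st; rewrite /pdcount; congr pdsum.
  by rewrite /n !size_cat st.
case/lastP: s ltms @n => [|s c] ltms n.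
  have := pdsum_scan beta (fun=> 1) (rev L) m.
  rewrite -rev_rcons revK size_rev -cats1 /n cats0 => ->.
  by rewrite scan_min ?all_rev // big1 // mul1r revK.
have := pdsum_scan beta (fun=> 1) (rev s ++ m :: rev L) c.
have -> : size (rev s ++ m :: rev L) = n.
  by rewrite /n !size_cat /= !size_rev size_rcons; lia.
have -> : rev (c :: rev s ++ m :: rev L) = L ++ m :: rcons s c.
  by rewrite rev_cons rev_cat rev_cons !revK cat_rcons rcons_cat.
move=> ->; rewrite scan_sweep ?rev_rcons //=.
by move: ltms; rewrite all_rcons all_rev.
Qed.

(** * Nonnegative coefficients and marked occurrences of 1423 *)

Definition nneg (q : Zb) : Prop := forall k, 0 <= q`_k.

Lemma nneg0 : nneg 0. Proof. by move=> k; rewrite coef0. Qed.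

Lemma nneg1 : nneg 1. Proof. by move=> k; rewrite coef1; case: eqP. Qed.

Lemma nnegD q r : nneg q -> nneg r -> nneg (q + r).
Proof. by move=> q0 r0 k; rewrite coefD addr_ge0. Qed.

Lemma nneg_beta q : nneg q -> nneg (beta * q).
Proof. by move=> q0 k; rewrite /beta coefXM; case: ifP. Qed.

(* [P] marks the letter in the role of 2 in every occurrence of 1423. *)
Definition marks1423 (P : pred nat) (w : seq nat) : Prop :=
  forall x y p q, subseq [:: x; y; p; q] w ->
    (x < p)%N -> (p < q)%N -> (q < y)%N -> P p.

Lemma marks1423_sub P Q w : subpred P Q -> marks1423 P w -> marks1423 Q w.
Proof. by move=> PQ Pw x y p q sub xp pq qy; apply: PQ; apply: Pw sub xp pq qy. Qed.

Lemma marks1423_subseq P v w : subseq v w -> marks1423 P w -> marks1423 P v.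
Proof. by move=> vw Pw x y p q sub; apply: Pw; apply: subseq_trans sub vw. Qed.

Lemma subseq_swap (t w s : seq nat) c a : subseq t (w ++ [:: c, a & s]) ->
  subseq t (w ++ [:: a, c & s]) \/ exists t1 t2, t = t1 ++ [:: c, a & t2] /\ subseq t2 s.
Proof.
elim: w t => [|d w IH] [|x t]; try by left; rewrite sub0seq.
  rewrite !cat0s; have [->|neq_xc] := eqVneq x c; last first.
    move=> sub; left; have {}sub : subseq (x :: t) (a :: s).
      by move: sub; rewrite /= (negbTE neq_xc).
    exact: subseq_trans sub (cat_subseq (subseq_refl [:: a]) (subseq_cons s c)).
  case: t => [|y t] sub; first by left; rewrite sub1seq !inE eqxx orbT.
  have {}sub : subseq (y :: t) (a :: s) by move: sub; rewrite /= eqxx.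
  have [eya|neq_ya] := eqVneq y a.
    by right; exists [::], t; split; [rewrite eya | move: sub; rewrite eya /= eqxx].
  have ts : subseq (y :: t) s by move: sub; rewrite /= (negbTE neq_ya).
  left; apply: subseq_trans (subseq_cons (c :: s) a).
  exact: cat_subseq (subseq_refl [:: c]) ts.
rewrite !cat_cons /=; case: eqP => [_|_] /IH; last by [].
by case=> [|[t1 [t2 [-> ts]]]]; [left|right; exists (x :: t1), t2].
Qed.

(* A new occurrence of 1423 using both [c] and [a] has [c] in the role of 2, which
   is marked, or in the role of 1, where it can be replaced by [m]. *)
Lemma marks1423_swap (P : pred nat) (L u s : seq nat) m a c : (m < c)%N -> (c < a)%N -> P c ->
  marks1423 P (L ++ m :: u ++ [:: a, c & s]) -> marks1423 P (L ++ m :: u ++ [:: c, a & s]).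
Proof.
move=> mc ca Pc Pw x y p q; rewrite -cat_cons catA => sub xp pq qy.
case: (subseq_swap sub) => [sub'|].
  by apply: (Pw x y p q) => //; rewrite -cat_cons catA.
case=> t1 [t2 [et ts]]; case: t1 et => [|x1 [|y1 [|p1 t1]]] [].
- move=> ex ey et2; subst x y t2; apply: (Pw m a p q) => //; last by lia.
  apply: subseq_trans (suffix_subseq _ _); rewrite -cat1s -[m :: u ++ _]cat1s.
  apply: cat_subseq => //; apply: subseq_trans (suffix_subseq _ _).
  apply: (cat_subseq (subseq_refl [:: a])); exact: subseq_trans ts (subseq_cons _ _).
- by move=> _ ey ep _; subst y p; lia.
- by move=> _ _ -> _.
- by move=> _ _ _; case: t1 => [|? []].
Qed.

(** * Positivity of the swept marked sums *)

Section Positivity.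

Variables (g : seq nat -> Zb) (P0 : pred nat) (L : seq nat) (m N : nat).

(** The induction hypothesis for words without the minimum [m]. In the application [g] is itself a
    marked sum over subwords of [L] with marks [P0], so the marks on [L] must stay fixed. *)
Hypothesis g_ge0 : forall P s, size s = N -> {in L, P =1 P0} -> uniq (L ++ s) ->
  all (ltn m) (L ++ s) -> marks1423 P (L ++ s) -> nneg (msum P g s).

Implicit Types (P : pred nat) (p s : seq nat) (oc : option nat).

Definition sweep_msum P p oc s : Zb :=
  msum P (fun p' => msum P (sweep beta g p' oc) s) p.

Definition admissible P p s : Prop :=
  [/\ {in L, P =1 P0}, uniq (L ++ rev p ++ s), all (ltn m) (L ++ rev p ++ s)
    & marks1423 P (L ++ m :: rev p ++ s)].

(** The terms in which [a] is present and stays, and those in which [a] is missing, combine to the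
    sum with [a] moved into the swept part. *)
Lemma sweep_msum_cons P p a s :
  sweep_msum P (a :: p) None s = sweep_msum P p None (a :: s) + sweep_msum P p (Some a) s.
Proof.
rewrite /sweep_msum /= msumB.
under [X in X - _]eq_msum => t _ do rewrite msumD.
rewrite msumD; have -> : msum P (fun t1 => if P a then 0 else
    msum P (sweep beta g t1 None) s) p =
    if P a then 0 else msum P (fun t1 => msum P (sweep beta g t1 None) s) p.
  by case: ifP => _ //; rewrite msum0.
by rewrite addrAC.
Qed.

(** The letters of [r] occur in every term, so they count as marked; the mark on [a] does not affect
    [p] and [s]. *)
Lemma sweep_msum_mark P p oc r s a : all [predU1 a & P] r -> a \notin p -> a \notin s ->
  sweep_msum [predU1 a & P] p oc (r ++ s) =
  msum P (fun t => msum P (fun u => sweep beta g t oc (r ++ u)) s) p.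
Proof.
have eqP' (l : seq nat) : a \notin l -> {in l, [predU1 a & P] =1 P}.
  by move=> al c cl /=; case: eqP cl => // ->; rewrite (negbTE al).
move=> Pr ap as'; rewrite /sweep_msum (eq_in_msum _ (eqP' _ ap)).
apply: eq_msum => t _; rewrite msum_cat msum_all //.
by apply: eq_in_msum; apply: eqP'.
Qed.

Lemma sweep_msum_mark0 P p oc s a : a \notin p -> a \notin s ->
  sweep_msum [predU1 a & P] p oc s = sweep_msum P p oc s.
Proof. exact: (@sweep_msum_mark P p oc [::]). Qed.

(** Terms in which [c] goes on beyond [a] absorb those in which [a] is missing; in the remaining
    terms [a] is always present, hence marked. *)
Lemma sweep_msum_carry P p a c s : (c < a)%N -> P c -> a \notin p -> a \notin s ->
  let Q := [predU1 a & P] in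
  sweep_msum P (a :: p) (Some c) s =
  sweep_msum P p (Some c) (a :: s) + (sweep_msum Q p None [:: c, a & s] +
  beta * (sweep_msum Q p None [:: a, c & s] + sweep_msum Q p (Some a) (c :: s))).
Proof.
move=> ca Pc ap as' Q; have cP : c \in P := Pc.
rewrite (@sweep_msum_mark P p None [:: c; a]) //=; last by rewrite cP eqxx !orbT.
rewrite (@sweep_msum_mark P p None [:: a; c]) //=; last by rewrite cP eqxx !orbT.
rewrite (@sweep_msum_mark P p (Some a) [:: c]) //=; last by rewrite cP !orbT.
rewrite /sweep_msum /= ca msumB.
have -> : msum P (fun t1 => if P a then 0 else msum P (sweep beta g t1 (Some c)) s) p =
    if P a then 0 else msum P (fun t1 => msum P (sweep beta g t1 (Some c)) s) p.
  by case: ifP => _ //; rewrite msum0.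
under [X in X - _]eq_msum => t _ do rewrite !(msumD, msumZ).
rewrite !(msumD, msumZ).
set x1 := msum P _ p; set x2 := msum P _ p; set x3 := msum P _ p; set x4 := msum P _ p.
set x5 := (if P a then _ else _).
by ring.
Qed.

(** A present [a] blocks [c]. A missing [a] is unmarked, and then [c] would have to pass a larger
    letter of [p]. *)
Lemma sweep_msum_block P p a c s : (a < c)%N -> (P a \/ all (fun z => z < c)%N p) ->
  sweep_msum P (a :: p) (Some c) s = 0.
Proof.
move=> ac Pap; rewrite /sweep_msum /= ltnNge ltnW //= !msum0 sub0r.
case: ifP => [|/negP nPa]; first by rewrite oppr0.
case: Pap => // ltp; rewrite -[RHS]oppr0; congr (- _).
rewrite -[RHS](msum0 _ P p); apply: eq_msum => -[|z t] sub.
  by rewrite -[RHS](msum0 _ P s); apply: eq_msum.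
have /= : (z < c)%N by apply: (allP ltp); apply: (mem_subseq sub); rewrite mem_head.
move=> zc; rewrite -[RHS](msum0 _ P s); apply: eq_msum => u _ /=.
by rewrite ltnNge ltnW.
Qed.

Lemma admissible_shift P p a s :
  admissible P (a :: p) s -> admissible P p (a :: s).
Proof. by rewrite /admissible rev_cons !cat_rcons. Qed.

Lemma admissible_mark P p s a : a \notin L ->
  admissible P p s -> admissible [predU1 a & P] p s.
Proof.
move=> aL [PP0 us ms Ps]; split=> //.
  move=> c cL; rewrite -PP0 //=.
  by case: eqP cL => // ->; rewrite (negbTE aL).
by apply: marks1423_sub Ps => c Pc; apply/orP; right.
Qed.

Lemma admissible_notin P p a s : admissible P p (a :: s) ->
  [/\ a \notin L, a \notin p & a \notin s].
Proof.
case=> _ us _ _; move: us; rewrite catA -cat1s uniq_catCA /= mem_cat mem_cat mem_rev.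
by rewrite !negb_or => /andP[/andP[/andP[-> ->] ->]].
Qed.

Lemma sweep_msum_ge0 p P :
  (forall s, size p + size s = N -> admissible P p s -> nneg (sweep_msum P p None s))%N /\
  (forall c s, size p + size s + 1 = N -> P c -> admissible P p (c :: s) ->
    nneg (sweep_msum P p (Some c) s))%N.
Proof.
elim: p P => [|a p IH] P; split=> [s|c s] /= sN.
- case=> PP0 us ms Ps; rewrite /sweep_msum /=; apply: g_ge0 => //.
  by apply: marks1423_subseq Ps; rewrite cat_subseq ?subseq_cons.
- by move=> _ _; rewrite /sweep_msum /= msum0; apply: nneg0.
- move=> /admissible_shift adm; rewrite sweep_msum_cons.
  have [aL ap as'] := admissible_notin adm.
  apply: nnegD; first by apply: (IH P).1 => //=; lia.
  (* The letter just picked up is in neither [p] nor [s], so it can be marked at no cost. *)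
  rewrite -(@sweep_msum_mark0 P p (Some a) s a) //.
  apply: (IH _).2; rewrite /= ?eqxx //; first by lia.
  exact: admissible_mark.
- move=> Pc /admissible_shift adm.
  have [aL ap acs] := admissible_notin adm.
  have /norP[neq_ac as'] : ~~ ((a == c) || (a \in s)) by rewrite -in_cons.
  have [ac|ca|eq_ac] := ltngtP a c; last by rewrite eq_ac eqxx in neq_ac.
    rewrite sweep_msum_block //; first exact: nneg0.
    have [Pa|nPa] := boolP (P a); [by left | right].
    case: adm => _ us ms Ps; apply/allP => z zp.
    apply: contraR nPa; rewrite -leqNgt => lecz.
    have subz : subseq [:: z; a; c] (rev p ++ [:: a, c & s]).
      apply: (@cat_subseq _ [:: z] [:: a; c]); first by rewrite sub1seq mem_rev.
      exact: prefix_subseq.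
    (* A letter [z > c] to the left of [a] would make [m z a c] an occurrence of 1423 with [a] as
       2. *)
    apply: (Ps m z a c) => //.
    + apply: subseq_trans (suffix_subseq _ _).
      exact: cat_subseq (subseq_refl [:: m]) subz.
    + by apply: (allP ms); rewrite !mem_cat mem_head !orbT.
    + rewrite ltn_neqAle lecz andbT; apply: contraTneq zp => <-.
      move: us; rewrite !cat_uniq => /and4P[_ _ _ /andP[/hasPn npc _]].
      by rewrite -mem_rev; apply: npc; rewrite !inE eqxx orbT.
  have adm' : admissible P p [:: c, a & s].
    have pe : perm_eq (L ++ rev p ++ [:: c, a & s]) (L ++ rev p ++ [:: a, c & s]).
      by rewrite !perm_cat2l (perm_catCA [:: c] [:: a]).
    case: adm => PP0 us ms Ps; split=> //.
    + by rewrite (perm_uniq pe).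
    + by rewrite (perm_all _ pe).
    apply: marks1423_swap Ps => //.
    by apply: (allP ms); rewrite !mem_cat !inE eqxx !orbT.
  rewrite sweep_msum_carry //; apply: nnegD.
    by apply: (IH P).2 => //=; lia.
  have Qa : [predU1 a & P] a by rewrite /= eqxx.
  apply: nnegD.
    by apply: (IH _).1; [rewrite /=; lia | apply: admissible_mark].
  apply: nneg_beta; apply: nnegD.
    by apply: (IH _).1; [rewrite /=; lia | apply: admissible_mark].
  by apply: (IH _).2 => //; [rewrite /=; lia | apply: admissible_mark].
Qed.

(** The subtracted sum is the part of the sweep in which no letter is ever carried; it will cancel
    against the subwords without [m]. *)
Lemma sweep_msum_ge P p s : (size p + size s = N)%N -> admissible P p s ->
  nneg (sweep_msum P p None s - msum P g (rev p ++ s)).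
Proof.
elim: p s => [|a p IH] s sN.
  by rewrite /sweep_msum /= subrr => _; apply: nneg0.
move=> /admissible_shift adm; have [aL ap as'] := admissible_notin adm.
rewrite sweep_msum_cons rev_cons cat_rcons addrAC; apply: nnegD.
  by apply: IH => //; rewrite -sN /=; lia.
rewrite -(@sweep_msum_mark0 P p (Some a) s a) //.
apply: (sweep_msum_ge0 _ _).2; rewrite /= ?eqxx //; first by rewrite -sN /=; lia.
exact: admissible_mark.
Qed.

End Positivity.

(** * Induction on the length by removing the minimum *)

Lemma min_split (w : seq nat) : uniq w -> w != [::] ->
  exists u m v, w = u ++ m :: v /\ all (ltn m) (u ++ v).
Proof.
move=> uw nw; have exm : exists m, m \in w.
  by case: w nw {uw} => // a w _; exists a; apply: mem_head.
case: (ex_minnP exm) => m mw minm; case/splitPr: mw uw minm => u v uw minm.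
exists u, m, v; split=> //; apply/allP => z zuv.
move: uw; rewrite -cat1s uniq_catCA /= => /andP[muv _].
rewrite /= ltn_neqAle minm ?andbT; first by apply: contraNneq muv => ->.
by move: zuv; rewrite !mem_cat inE => /orP[->|->]; rewrite ?orbT.
Qed.

Lemma msum_pdcount_ge0 (P : pred nat) w : uniq w -> marks1423 P w -> nneg (msum P pdcount w).
Proof.
have [n] := ubnP (size w); elim: n P w => // n IH P w; rewrite ltnS => sw uw Pw.
have [->|/(min_split uw)[L [m [s [ew ltm]]]]] := eqVneq w [::]; first exact: nneg1.
subst w; pose g t := msum P (fun u => pdcount (u ++ t)) L.
have g_ge0 Q t : size t = size s -> {in L, Q =1 P} -> uniq (L ++ t) ->
    all (ltn m) (L ++ t) -> marks1423 Q (L ++ t) -> nneg (msum Q g t).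
  move=> st QP ut _ Qt; rewrite (_ : msum Q g t = msum Q pdcount (L ++ t)).
    by apply: IH => //; rewrite size_cat st; rewrite size_cat addnS /= in sw.
  rewrite msum_cat exchange_msum; apply: eq_msum => t' _.
  by rewrite /g (eq_in_msum _ QP).
have adm : admissible P L m P (rev s) [::].
  rewrite /admissible revK cats0; split=> //.
  by move: uw; rewrite -cat1s uniq_catCA => /andP[].
(* Subwords containing [m] are swept; those without [m], allowed only if [m] is unmarked, are
   subtracted. *)
have e1 : msum P pdcount (L ++ m :: s) = sweep_msum g P (rev s) None [::] -
    (if P m then 0 else msum P g s).
  rewrite msum_cat /= msumB; congr (_ - _).
    rewrite exchange_msum /sweep_msum msum_rev; apply: eq_msum => t ts /=.
    transitivity (msum P (fun u =>
        sweep beta (fun t' => pdcount (u ++ t')) (rev t) None [::]) L); last first.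
      exact: msum_sweep.
    apply: eq_msum => u uL; apply: pdcount_sweep; apply/allP => z zut.
    by apply: (allP ltm); apply: (mem_subseq _ zut); apply: cat_subseq.
  by case: ifP => _; rewrite ?msum0 // exchange_msum.
have := sweep_msum_ge g_ge0 _ adm; rewrite revK cats0 size_rev addn0 e1 => /(_ erefl).
(* If [m] is marked nothing is subtracted, and [msum P g s], nonnegative by induction, is added
   back. *)
case: ifP => // _ /nnegD diff_ge0; rewrite subr0 -(subrK (msum P g s) (sweep_msum _ _ _ _ _)).
have sub : subseq (L ++ s) (L ++ m :: s) by rewrite cat_subseq ?subseq_cons.
apply: diff_ge0; apply: g_ge0 => //; last exact: marks1423_subseq Pw.
exact: subseq_uniq uw.
Qed.

Theorem theorem1p4 (w : seq nat) :
  is_perm w -> pcount [:: 1; 4; 2; 3]%N w = 0%N ->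
  forall k : nat, 0 <= (cpoly w)`_k.
Proof.
move=> pw avoid; have uw : uniq w by rewrite (perm_uniq pw) iota_uniq.
have -> : cpoly w = msum pred0 pdcount w.
  rewrite msum_mask; apply: eq_bigr => m _; congr (_ * _).
  by rewrite upsilon_std ?mask_uniq.
(* Without occurrences of 1423, the empty set of marks is enough. *)
apply: msum_pdcount_ge0 => // x y p q /subseqP[m sm xypq] xp pq qy.
have tm : size m == size w by apply/eqP.
move/eqP: avoid; rewrite cards_eq0 => /eqP/setP/(_ (Tuple tm)).
have F a c : (a < c)%N -> (c < a)%N = false by move=> ac; rewrite ltnNge ltnW.
have xq := ltn_trans xp pq; have py := ltn_trans pq qy; have xy := ltn_trans xp py.
rewrite !inE -xypq /std /= !ltnn xp pq qy xq py xy.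
by rewrite (F _ _ xp) (F _ _ pq) (F _ _ qy) (F _ _ xq) (F _ _ py) (F _ _ xy).
Qed.
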